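(* Let $\mathcal A$ be a central hyperplane arrangement with base region $B$. If the directed graph $\mathcal Q(\mathcal A,B)$ is acyclic, then the order dimension of the poset of regions satisfies $\dim(\mathcal P(\mathcal A,B))\le\chi(G(\mathcal A,B))$, where $\chi(G(\mathcal A,B))$ is the chromatic number of the basic graph $G(\mathcal A,B)$.
   Context: A (central) arrangement $\mathcal A$ is a finite, nonempty collection of codimension-1 linear subspaces (hyperplanes) of $\mathbb R^n$. Its regions are the closures of the connected components of $\mathbb R^n\setminus\bigcup_{H\in\mathcal A}H$. Fix a region $B$, the base region. For a region $R$, the separating set $S(R)$ is the set of hyperplanes of $\mathcal A$ separating $R$ from $B$. The poset of regions $\mathcal P(\mathcal A,B)$ is the set of regions with $R_1\le R_2$ if and only if $S(R_1)\subseteq S(R_2)$. A subset $\mathcal A'\subseteq\mathcal A$ is a rank-two subarrangement if $|\mathcal A'|>1$ and there is a codimension-two linear subspace $L$ such that $\mathcal A'$ is the set of all hyperplanes of $\mathcal A$ containing $L$. Let $B'$ be the unique region of $\mathcal A'$ containing $B$; the (two) hyperplanes of $\mathcal A'$ bounding $B'$ are called basic in $\mathcal A'$. The basic graph $G(\mathcal A,B)$ is the undirected graph with vertex set $\mathcal A$ and edges $\{H_1,H_2\}$ whenever $H_1$ and $H_2$ are the basic hyperplanes in some rank-two subarrangement. The directed graph $\mathcal Q(\mathcal A,B)$ has vertex set $\mathcal A$, with $H\to H'$ whenever $H$ is a basic hyperplane in some rank-two subarrangement and $H'$ is a non-basic hyperplane in the same rank-two subarrangement. The order dimension $\dim(P)$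 of a finite poset $P$ is the smallest $d$ such that $P$ embeds as an induced subposet of $\mathbb R^d$ with the componentwise order. *)

(* Defs.v *)
From HB Require Import structures.
From mathcomp Require Import all_boot all_order all_algebra finmap.
From mathcomp Require Import all_classical all_reals.
From mathcomp Require Import topology normedtype.
From Stdlib Require Import Relation_Operators.
Set Implicit Arguments.
Unset Strict Implicit.
Unset Printing Implicit Defensive.
Import Order.TTheory GRing.Theory Num.Theory.
Import numFieldNormedType.Exports.

Local Open Scope fset_scope.
Local Open Scope classical_set_scope.
Local Open Scope ring_scope.

Definition is_least (P : nat -> Prop) (m : nat) : Prop :=
  P m /\ forall k, P k -> (m <= k)%N.

Lemma is_least_unique (P : nat -> Prop) (m1 m2 : nat) :
  is_least P m1 -> is_least P m2 -> m1 = m2.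
Proof.
move=> [P1 min1] [P2 min2].
by apply/eqP; rewrite eqn_leq min1 // min2.
Qed.

Section Combinatorics.
Variable T : choiceType.

(* A directed cycle is a closed directed walk of length at least one. *)
Definition acyclic (E : T -> T -> Prop) : Prop :=
  forall v, ~ clos_trans T E v v.

Definition colorable (V : {fset T}) (E : T -> T -> Prop) (k : nat) : Prop :=
  exists c : T -> nat,
    (forall v, v \in V -> (c v < k)%N) /\
    (forall u v, u \in V -> v \in V -> E u v -> c u <> c v).

Definition is_chromatic_number (V : {fset T}) (E : T -> T -> Prop) :=
  is_least (colorable V E).

End Combinatorics.

Section OrderDimension.
Variables (R : realType) (T : Type).

(* The subset [P] of [T], ordered by [le], is isomorphic to an induced
   subposet of R^d with the componentwise order. *)
Definition embeds_in_Rd (P : set T) (le : T -> T -> Prop) (d : nat) : Prop :=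
  exists f : T -> 'rV[R]_d,
    (forall x y, P x -> P y -> f x = f y -> x = y) /\
    (forall x y, P x -> P y -> (le x y <-> forall i, f x 0 i <= f y 0 i)).

Definition is_order_dimension (P : set T) (le : T -> T -> Prop) :=
  is_least (embeds_in_Rd P le).

End OrderDimension.

Section Arrangements.
Variables (R : realType) (n : nat).

Local Notation space := 'rV[R]_n.
Implicit Types (A : {fset {vspace space}}) (H L : {vspace space}).
Implicit Types (B X Y : set space).

Definition arrangement A : Prop :=
  A != fset0 /\ forall H, H \in A -> (\dim H).+1 = n.

Definition arr_complement A : set space :=
  [set x | forall H, H \in A -> x \notin H].

Definition region A : set (set space) :=
  [set X | exists2 x, arr_complement A x &
     X = closure (connected_component (arr_complement A) x)].

(* [X] and [Y] lie in opposite closed half-spaces bounded by [H].  Regions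
   have nonempty interior, so for them this is strict on interiors and fails
   for X = Y. *)
Definition separates H X Y : Prop :=
  exists f : 'Hom(space, R^o),
    [/\ lker f = H,
        (forall x, X x -> f x <= 0 :> R) &
        (forall y, Y y -> 0 <= f y :> R)].

Definition sep_set A B X : set {vspace space} :=
  [set H | H \in A /\ separates H X B].

Definition region_le A B X Y : Prop := sep_set A B X `<=` sep_set A B Y.

Definition rank_two_subarrangement A A' : Prop :=
  (1 < #|` A'|)%N /\
  exists L, (\dim L).+2 = n /\ A' = [fset H in A | (L <= H)%VS].

(* [H] meets [X] in a facet, i.e. in a set of dimension [\dim H]; since
   regions are convex cones containing 0, this says that the linear span of
   the intersection of [X] and [H] is all of [H].  Merely touching [H] would
   not do: in a rank-two subarrangement every hyperplane meets every region
   at least in the codimension-two subspace [L]. *)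
Definition bounds H X : Prop :=
  forall U : {vspace space},
    (forall x, X x -> x \in H -> x \in U) -> (H <= U)%VS.

Definition basic A' B H : Prop :=
  H \in A' /\ exists B', [/\ region A' B', B `<=` B' & bounds H B'].

Definition basic_graph A B H1 H2 : Prop :=
  H1 <> H2 /\
  exists A', [/\ rank_two_subarrangement A A', basic A' B H1 & basic A' B H2].

Definition basic_digraph A B H H' : Prop :=
  exists A', [/\ rank_two_subarrangement A A', basic A' B H,
                 H' \in A' & ~ basic A' B H'].

End Arrangements.

(* Main.v *)
Require Import Defs.
From mathcomp Require Import all_boot all_order all_algebra finmap.
From mathcomp Require Import all_classical all_reals.
From mathcomp Require Import topology normedtype.
From mathcomp Require Import ring lra zify.
From Stdlib Require Import Relation_Operators.
Import Order.TTheory GRing.Theory Num.Theory.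
Import numFieldNormedType.Exports.

(** Let [k] colours be a proper colouring of the basic graph. The poset of
    regions is embedded in [R^k] by giving a region [X] one coordinate per
    colour [i]: the sum, over the hyperplanes [H] of colour [i] in [S(X)], of a
    weight that decreases so fast with the rank of [H] in a topological order
    of the digraph Q that the hyperplane of least rank in which two separating
    sets differ decides the comparison ([score_lt]). Each coordinate is
    monotone in [S(X)].

    It remains to see that if [S(X)] is not included in [S(Y)], some coordinate
    is larger for [X] than for [Y] ([scores_embed]). Take [H] of least rank in
    [S(X) \ S(Y)]. It suffices that every [H'] of the same colour in
    [S(Y) \ S(X)] has larger rank than [H] ([first_difference_rank]). In the
    rank-two subarrangement spanned by [H] and [H'], the basic hyperplane [K]
    on the side of [H] is also in [S(X) \ S(Y)] ([extreme_basic]). So [H] is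
    basic, as otherwise Q would have an arc from [K] to [H], against the
    minimality of [H]. As [H] and [H'] have the same colour they are not both
    basic, hence Q has an arc from [H] to [H'].

    Geometrically, each hyperplane [H] is given a linear form
    [phi H] with kernel [H] and value 1 at a point [b] inside the base region.
    A region is then a closed cone given by signs of the forms ([regionP]), and
    [H] separates the region of [x] from the base exactly when [phi H x] is
    negative ([separates_cone]); a region is determined by its separating set
    ([cone_eq]). *)

Set Implicit Arguments.
Unset Strict Implicit.
Unset Printing Implicit Defensive.

Local Open Scope fset_scope.
Local Open Scope classical_set_scope.
Local Open Scope ring_scope.

(** * Linear forms of hyperplanes *)

Section Forms.
Context {R : realType} {n : nat}.
Local Notation space := 'rV[R]_n.
Local Notation form := 'Hom(space, R^o).
Implicit Types (H : {vspace space}) (f g : form).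

Lemma functionalZ f (a : R) x : f (a *: x) = a * f x :> R.
Proof. by rewrite linearZ. Qed.

(** On row vectors a linear form is a combination of the coordinates. *)
Lemma form_continuous f : continuous (f : space -> R).
Proof.
have -> : (f : space -> R) = \sum_i (fun x : space => x 0 i * f (delta_mx 0 i)).
  apply/funext => x; rewrite fct_sumE {1}[x]row_sum_delta linear_sum.
  by apply: eq_bigr => i _; rewrite linearZ.
elim/big_ind: _ => [|g h cg ch|i _] x; first exact: cst_continuous.
  by apply: continuousD; [exact: cg|exact: ch].
have cc := @coord_continuous R 1 n 0 i x.
by apply: (@cvgM R space (nbhs x)); [exact: cc|exact: cvg_cst].
Qed.

(** The coordinate along [b] in the decomposition of the space as the direct
    sum of the line of [b] and the hyperplane [H]. *)
Lemma hyperplane_form H b : (\dim H).+1 = n -> b \notin H ->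
  exists f : form, lker f = H /\ f b = 1 :> R.
Proof.
move=> dimH bH.
have b0 : b != 0 by apply: contraNneq bH => ->; exact: mem0v.
have db : \dim <[b]> = 1%N by rewrite dim_vline b0.
have capbH : (<[b]> :&: H = 0)%VS.
  apply/eqP; rewrite -subv0; apply/subvP => _ /memv_capP[/vlineP[c ->]].
  have [->|c0] := eqVneq c 0; first by move=> _; rewrite scale0r mem0v.
  by rewrite rpredZeq (negbTE c0) (negbTE bH).
have addbH x : x \in (<[b]> + H)%VS.
  have -> : (<[b]> + H = fullv)%VS; last exact: memvf.
  apply/eqP; rewrite eqEdim subvf dimvf /dim /= mul1n.
  by rewrite dimv_disjoint_sum // db add1n dimH.
have coordb y : y \in <[b]>%VS -> y = coord [tuple b] 0 y *: b.
  by move=> yb; rewrite [LHS](coord_span (X := [tuple b])) ?big_ord1 // span_seq1.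
pose g : {linear space -> R^o} := coord [tuple b] 0 \o daddv_pi <[b]> H.
have dec x : x = (g x : R) *: b + daddv_pi H <[b]> x.
  by rewrite -[LHS](daddv_pi_add capbH (addbH x)) -coordb // memv_pi.
exists (linfun g); split; last first.
  rewrite lfunE /= daddv_pi_id ?memv_line//.
  have := coordb b (memv_line b).
  set c := coord _ _ _ => h; apply/eqP; rewrite -subr_eq0.
  have: (c - 1) *: b == 0 by rewrite scalerBl -h scale1r subrr.
  by rewrite scaler_eq0 (negbTE b0) orbF.
apply/vspaceP => x; rewrite memv_ker lfunE; apply/eqP/idP => [gx|xH].
  by rewrite (dec x) gx scale0r add0r memv_pi.
have : (g x : R) *: b \in H.
  have -> : (g x : R) *: b = x - daddv_pi H <[b]> x by rewrite {2}(dec x) addrK.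
  by rewrite memvB // memv_pi.
by rewrite rpredZeq (negbTE bH) orbF => /eqP.
Qed.

(** Two forms with the same kernel are proportional, so the form that
    witnesses a separation can be replaced by any other form cutting out the
    hyperplane. *)
Lemma form_unique f g (b : space) :
  lker f = lker g -> f b = 1 :> R -> forall x, g x = g b * f x :> R.
Proof.
move=> fg fb x.
have lin (h : form) : h (x - (f x : R) *: b) = h x - f x * h b :> R.
  by rewrite linearB linearZ.
have : x - (f x : R) *: b \in lker g by rewrite -fg memv_ker lin fb mulr1 subrr.
by rewrite memv_ker lin subr_eq0 => /eqP ->; rewrite mulrC.
Qed.

End Forms.

(** * Regions as cones *)

Section Cells.
Context {R : realType} {n : nat}.
Local Notation space := 'rV[R]_n.
Local Notation form := 'Hom(space, R^o).
Implicit Types (A : {fset {vspace space}}) (H : {vspace space}).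
Implicit Types (phi : {vspace space} -> form).

(** Quantifying over the members of [A] makes a family chosen for [A] serve
    all its subarrangements. *)
Definition cuts_out A phi := forall H, H \in A -> lker (phi H) = H.

Lemma normalized_forms A (b : space) :
  arrangement A -> arr_complement A b ->
  exists phi : {vspace space} -> form,
    cuts_out A phi /\ forall H, H \in A -> phi H b = 1 :> R.
Proof.
move=> [_ dimA] bA.
have ex H : exists f : form, H \in A -> lker f = H /\ f b = 1 :> R.
  have [HA|HA] := boolP (H \in A); last by exists 0.
  by have [f fP] := hyperplane_form (dimA H HA) (bA H HA); exists f.
have [phi phiP] := choice ex.
by exists phi; split=> H /phiP[].
Qed.

Definition cell A phi x : set space :=
  [set y | forall H, H \in A -> 0 < (phi H x : R) * phi H y].

Definition cone A phi x : set space :=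
  [set y | forall H, H \in A -> 0 <= (phi H x : R) * phi H y].

Lemma form_neq0 A phi H x : cuts_out A phi -> H \in A ->
  (phi H x != 0) = (x \notin H).
Proof. by move=> ker HA; rewrite -memv_ker ker. Qed.

Lemma cell_self A phi x : cuts_out A phi -> arr_complement A x -> cell A phi x x.
Proof.
move=> ker xA H HA; rewrite -expr2 exprn_even_gt0//=.
by rewrite (form_neq0 _ ker HA) xA.
Qed.

(** A cell is star-shaped around [x], hence connected, which bounds the
    component from below. Conversely a form of the arrangement maps the
    component onto an interval that avoids 0, so it cannot change sign. *)
Lemma component_cell A phi x : cuts_out A phi -> arr_complement A x ->
  connected_component (arr_complement A) x = cell A phi x.
Proof.
move=> ker xA; apply/seteqP; split=> [y Cy H HA|y cy].
  set C := connected_component _ x in Cy.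
  have Cx : C x by exact: connected_component_refl.
  have CA z : C z -> phi H z != 0.
    by move=> /connected_component_sub Az; rewrite (form_neq0 _ ker HA) Az.
  have itv : is_interval ((phi H : space -> R) @` C).
    apply/connected_intervalP/connected_continuous_connected.
      exact: component_connected.
    by apply: continuous_subspaceT; exact: form_continuous.
  (* Values of opposite sign at x and y would force the interval to contain 0. *)
  rewrite ltNge; apply/negP => xy0.
  suff [z Cz z0] : ((phi H : space -> R) @` C) 0 by move: (CA z Cz); rewrite z0 eqxx.
  have Ix : ((phi H : space -> R) @` C) (phi H x) by exists x.
  have Iy : ((phi H : space -> R) @` C) (phi H y) by exists y.
  have [x0|x0] := leP (phi H x : R) 0.
    apply: (itv _ _ Ix Iy); rewrite x0 /= leNgt; apply/negP => y0.
    move: (CA x Cx).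
    by rewrite neq_lt => /orP[|]; nra.
  by apply: (itv _ _ Iy Ix); rewrite (ltW x0) andbT; nra.
pose seg (t : R) : space := x + t *: (y - x).
have segc : continuous seg.
  move=> t; apply: cvgD; first exact: cvg_cst.
  by apply: cvgZr_tmp; exact: cvg_id.
apply: (@connected_component_max _ _ (seg @` `[0, 1])); last 2 first.
- apply: connected_continuous_connected; first exact: segment_connected.
  exact: continuous_subspaceT.
- by exists 1; rewrite /= ?in_itv /= ?ler01 ?lexx // /seg scale1r addrC subrK.
- by exists 0; rewrite /= ?in_itv /= ?ler01 ?lexx // /seg scale0r addr0.
move=> _ [t /= + <-] H HA; rewrite in_itv /= => /andP[t0 t1].
rewrite -(form_neq0 _ ker HA) /seg linearD linearZ linearB /=.
have := cy H HA; have := cell_self ker xA HA.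
move: (phi H x : R) (phi H y : R) => u v uu uv.
suff : 0 < u * (u + t * (v - u)) by apply: contraTneq => ->; rewrite mulr0 ltxx.
have -> : u * (u + t * (v - u)) = (1 - t) * (u * u) + t * (u * v) by ring.
have [<-|tn0] := eqVneq 0 t; first by rewrite subr0 mul1r mul0r addr0.
apply: ltr_wpDl; first by rewrite mulr_ge0 ?subr_ge0 // ltW.
by rewrite mulr_gt0 // lt0r eq_sym tn0.
Qed.

(** A point [y] of the closed cone is the limit, as [t] decreases to 0, of the
    points [y + t *: x] of the open cell. *)
Lemma closure_cell A phi x : cuts_out A phi -> arr_complement A x ->
  closure (cell A phi x) = cone A phi x.
Proof.
move=> ker xA; apply/seteqP; split=> [y cy|y cy U Uy].
  move=> H HA.
  have clH : closed [set z | 0 <= (phi H x : R) * phi H z].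
    apply: (@closed_comp _ _ (fun z => (phi H x : R) * phi H z) [set r | 0 <= r]).
      move=> z _; apply: (@cvgM R space (nbhs z)); first exact: cvg_cst.
      exact: form_continuous.
    exact: closed_ge.
  suff : cell A phi x `<=` [set z | 0 <= (phi H x : R) * phi H z].
    by move/closureS/(_ y cy); rewrite -((closure_id _).1 clH).
  by move=> z cz; exact/ltW/cz.
pose ray (t : R) : space := y + t *: x.
have rayc : ray t @[t --> (0:R)^'+] --> y + 0 *: x.
  apply: cvgD; first exact: cvg_cst.
  by apply: cvgZr_tmp; apply: cvg_at_right_filter; exact: cvg_id.
rewrite scale0r addr0 in rayc.
have : \forall t \near 0^'+, U (ray t) by exact: rayc.
have : \forall t \near (0:R)^'+, 0 < t by exact: nbhs_right_gt.
move=> pos near; have [t [t0 Ut]] := filter_ex (filterI pos near).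
exists (ray t); split => // H HA.
rewrite /ray linearD linearZ /= mulrDr.
have := cy H HA; have := cell_self ker xA HA.
move: (phi H x : R) (phi H y : R) => u v uu uv.
by have := mulr_gt0 t0 uu; rewrite -[t *: u]/(t * u); nra.
Qed.

Lemma regionP A phi X : cuts_out A phi ->
  region A X <-> exists2 x, arr_complement A x & X = cone A phi x.
Proof.
by move=> ker; split=> -[x xA ->]; exists x => //;
  rewrite (component_cell ker xA) (closure_cell ker xA).
Qed.

End Cells.

(** * Separating sets *)

Section Separation.
Context {R : realType} {n : nat}.
Local Notation space := 'rV[R]_n.
Local Notation form := 'Hom(space, R^o).
Context (A : {fset {vspace space}}) (b : space) (phi : {vspace space} -> form).
Context (ker : cuts_out A phi).
Context (phib : forall H, H \in A -> phi H b = 1 :> R).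
Implicit Types (H : {vspace space}).

Lemma base_in_complement : arr_complement A b.
Proof. by move=> H HA; rewrite -(form_neq0 _ ker HA) phib ?oner_neq0. Qed.

Lemma base_coneE y : cone A phi b y <-> forall H, H \in A -> 0 <= phi H y :> R.
Proof.
by split=> h H HA; have := h H HA; rewrite phib // mul1r.
Qed.

(** The witness of a separation is a multiple of [phi H] by its value at [b],
    which is positive since [b] is in the base cone and off [H]. *)
Lemma separates_cone x H : arr_complement A x -> H \in A ->
  separates H (cone A phi x) (cone A phi b) <-> phi H x < 0 :> R.
Proof.
move=> xA HA; split=> [[f [kf fx fb]]|x0].
  have Cx : cone A phi x x by move=> K KA; exact/ltW/(cell_self ker xA KA).
  have Cb : cone A phi b b.
    by move=> K KA; exact/ltW/(cell_self ker base_in_complement KA).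
  have fE : forall y, f y = f b * phi H y :> R.
    by apply: form_unique; [rewrite ker|exact: phib].
  have fbn0 : f b != 0 by rewrite -memv_ker kf base_in_complement.
  have fb0 : 0 < (f b : R) by rewrite lt0r fbn0 fb.
  rewrite lt_neqAle (form_neq0 _ ker HA) xA //=.
  by have := fx x Cx; rewrite fE pmulr_rle0.
exists (phi H); split=> [|y /(_ H HA)|y /base_coneE]; last exact.
  exact: ker.
by rewrite nmulr_rge0.
Qed.

Lemma sep_setP x H : arr_complement A x ->
  sep_set A (cone A phi b) (cone A phi x) H <-> H \in A /\ phi H x < 0 :> R.
Proof.
by move=> xA; split=> -[HA /(separates_cone xA HA) sep]; split.
Qed.

(** A cone is cut out by the signs of the forms, and these are what the
    separating set records. *)
Lemma cone_eq x y : arr_complement A x -> arr_complement A y ->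
  sep_set A (cone A phi b) (cone A phi x) =
  sep_set A (cone A phi b) (cone A phi y) -> cone A phi x = cone A phi y.
Proof.
move=> xA yA eS.
have sgn H : H \in A -> ((phi H x : R) < 0) = ((phi H y : R) < 0).
  move=> HA; apply/idP/idP => h.
    have /sep_setP : sep_set A (cone A phi b) (cone A phi y) H.
      by rewrite -eS; apply/sep_setP.
    by case=> //.
  have /sep_setP : sep_set A (cone A phi b) (cone A phi x) H.
    by rewrite eS; apply/sep_setP.
  by case=> //.
apply/seteqP; split=> z cz H HA; have := cz H HA.
all: move: (xA H HA) (yA H HA) (sgn H HA); rewrite -!(form_neq0 _ ker HA).
all: move: (phi H x : R) (phi H y : R) (phi H z : R) => u v w.
all: by rewrite !neq_lt; do 2!case: ltP => //= ?; nra.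
Qed.

End Separation.

(** * Rank-two subarrangements *)

Section RankTwo.
Context {R : realType} {n : nat}.
Local Notation space := 'rV[R]_n.
Local Notation form := 'Hom(space, R^o).
Implicit Types (H : {vspace space}) (A : {fset {vspace space}}).

(** The rank-two subarrangement spanned by two distinct hyperplanes. *)
Definition pencil A H H' := [fset K in A | (H :&: H' <= K)%VS].

Lemma pencil_rank_two A H H' : arrangement A -> H \in A -> H' \in A -> H != H' ->
  rank_two_subarrangement A (pencil A H H').
Proof.
move=> [_ dimA] HA H'A neq; split.
  have <- : #|` [fset H; H']| = 2%N by rewrite cardfs2 neq.
  apply: fsubset_leq_card; apply/fsubsetP => K.
  by rewrite !inE => /orP[] /eqP ->; rewrite ?HA ?H'A /= ?capvSl ?capvSr.
exists (H :&: H')%VS; split => //.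
have eqdim : \dim H = \dim H' by apply: succn_inj; rewrite !dimA.
have nsub : ~~ (H' <= H)%VS.
  apply: contra neq => sub.
  by rewrite eq_sym eqEdim sub eqdim leqnn.
have lt : (\dim H < \dim (H + H'))%N.
  rewrite ltn_neqAle dimvS ?addvSl // andbT.
  apply: contra nsub => /eqP e.
  have /eqP -> : (H == H + H')%VS by rewrite eqEdim addvSl e leqnn.
  exact: addvSr.
have le : (\dim (H + H') <= n)%N.
  by have := dimvS (subvf (H + H')%VS); rewrite dimvf /dim /= mul1n.
have := dimv_sum_cap H H'; rewrite -eqdim; have := dimA H HA.
by lia.
Qed.

Context (A : {fset {vspace space}}) (b : space) (phi : {vspace space} -> form).
Context (arrA : arrangement A) (ker : cuts_out A phi).
Context (phib : forall H, H \in A -> phi H b = 1 :> R).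

(** The key geometric fact. Normalised by the value 1 at [b], the forms of the
    pencil lie on one affine line, [phi K = phi H' + s K (phi H - phi H')],
    with [s H' = 0] and [s H = 1]. A hyperplane [K] with [s K] maximal is
    extreme among them, so it is basic, and [H] lies between [K] and [H'], so
    [phi H] is a combination of [phi K] and [phi H'] with nonnegative
    coefficients [1 / s K] and [1 - 1 / s K]. *)
Lemma extreme_basic H H' : H \in A -> H' \in A -> H != H' ->
  exists K : {vspace space}, exists a c : R,
    [/\ basic (pencil A H H') (cone A phi b) K, 0 < a, 0 <= c &
      forall y, phi H y = a * phi K y + c * phi H' y :> R].
Proof.
move=> HA H'A neq; have [_ dimA] := arrA.
have HP : H \in pencil A H H' by rewrite !inE HA capvSl.
have PA K : K \in pencil A H H' -> K \in A by rewrite !inE => /andP[].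
have /subvPn[v0 v0H' v0H] : ~~ (H' <= H)%VS.
  apply: contra neq => sub; rewrite eq_sym eqEdim sub /=.
  by rewrite -ltnS !dimA.
have Hv0 : phi H v0 != 0 by rewrite (form_neq0 _ ker HA).
(* The parameter s K of the affine line is the value of phi K at v. *)
pose v := (phi H v0 : R)^-1 *: v0.
have Hv : phi H v = 1 :> R by rewrite functionalZ mulVf.
have H'v : phi H' v = 0 :> R.
  rewrite functionalZ; apply/eqP; rewrite mulf_eq0; apply/orP; right.
  by rewrite -memv_ker ker.
have pencilE K y : K \in pencil A H H' ->
    phi K y = phi H' y + phi K v * (phi H y - phi H' y) :> R.
  move=> KP; have KA := PA K KP.
  pose l := y - ((phi H' y : R) *: b + (phi H y - phi H' y : R) *: v).
  have lE M : phi M l = phi M y - (phi H' y * phi M b + (phi H y - phi H' y) * phi M v) :> R.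
    by rewrite /l linearB linearD !linearZ.
  have lL : l \in (H :&: H')%VS.
    rewrite memv_cap -{1}(ker HA) -{1}(ker H'A) !memv_ker !lE !phib // Hv H'v.
    by apply/andP; split; apply/eqP; ring.
  have : phi K l = 0 :> R.
    move: KP; rewrite !inE => /andP[_ /subvP/(_ l lL)].
    by rewrite -{1}(ker KA) memv_ker => /eqP.
  by rewrite lE phib // => h; apply/eqP; rewrite -subr_eq0 -h; apply/eqP; ring.
have [[K KP] _ Kmax] := @arg_maxP _ _ _ [` HP] predT (fun M => phi (val M) v : R) isT.
have {}Kmax M : M \in pencil A H H' -> (phi M v : R) <= phi K v.
  by move=> MP; exact: (Kmax [` MP] isT).
have KA := PA K KP.
have s1 : 1 <= (phi K v : R) by rewrite -Hv Kmax.
have s0 : 0 < (phi K v : R) by exact: lt_le_trans s1.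
exists K, (phi K v : R)^-1, (1 - (phi K v : R)^-1); split; last first.
- move=> y; rewrite (pencilE K y KP); field; exact: lt0r_neq0.
- by rewrite subr_ge0 invf_le1.
- by rewrite invr_gt0.
have kerP : cuts_out (pencil A H H') phi by move=> M /PA; exact: ker.
have phibP M : M \in pencil A H H' -> phi M b = 1 :> R by move=> /PA; exact: phib.
split=> //; exists (cone (pencil A H H') phi b); split.
- apply/(regionP _ kerP); exists b => //.
  exact: base_in_complement kerP phibP.
- by move=> y By M /PA; exact: By.
move=> U KU; apply/subvP => z zK.
(* On K, every form of the pencil is a nonnegative multiple of phi H', so the
   half of K where phi H' is nonnegative is in the base region of the pencil,
   and this half spans K. *)
have half y : y \in K -> 0 <= (phi H' y : R) -> y \in U.
  move=> yK H'y; apply: KU => //; apply/(base_coneE phibP) => M MP.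
  have : phi K y = 0 :> R by apply/eqP; rewrite -memv_ker ker.
  rewrite (pencilE K y KP) (pencilE M y MP); have := Kmax M MP; move: s0 H'y.
  move: (phi K v : R) (phi M v : R) (phi H y : R) (phi H' y : R) => s t p q s0 q0 ts e.
  have spq : s * (p - q) = - q by lra.
  have -> : p - q = - q / s by apply/esym; rewrite -{1}spq mulrC mulKf ?lt0r_neq0.
  have -> : q + t * (- q / s) = q * ((s - t) / s) by field; exact: lt0r_neq0.
  by rewrite mulr_ge0 // divr_ge0 ?subr_ge0 // ltW.
have [|neg] := leP 0 (phi H' z : R); first exact: half.
rewrite -memvN; apply: half; first by rewrite memvN.
by rewrite linearN oppr_ge0 ltW.
Qed.

(** Write [S(z)] for the set of hyperplanes whose form is negative at [z]. Here
    [H] is an element of least rank of [S(x) \ S(y)] and [H'] belongs to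
    [S(y) \ S(x)]. The basic hyperplane [K] of [extreme_basic] is also in
    [S(x) \ S(y)]. If [H] were not basic, the arc from [K] to [H] would
    contradict minimality. So [H] is basic, [H'] is not because the two are
    not adjacent in the basic graph, and there is an arc from [H] to [H']. *)
Lemma first_difference_rank (rk : {vspace space} -> nat) x y H H' :
  (forall K K', K \in A -> K' \in A ->
     basic_digraph A (cone A phi b) K K' -> (rk K < rk K')%N) ->
  H \in A -> H' \in A -> ~ basic_graph A (cone A phi b) H H' ->
  phi H x < 0 :> R -> 0 <= phi H y :> R ->
  0 <= phi H' x :> R -> phi H' y < 0 :> R ->
  (forall K, K \in A -> phi K x < 0 :> R -> 0 <= phi K y :> R ->
     (rk H <= rk K)%N) ->
  (rk H < rk H')%N.
Proof.
move=> rkQ HA H'A indep Hx Hy H'x H'y Hmin.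
have neq : H != H' by apply: contraTneq Hx => ->; rewrite -leNgt.
have P2 := pencil_rank_two arrA HA H'A neq.
have HP : H \in pencil A H H' by rewrite !inE HA capvSl.
have H'P : H' \in pencil A H H' by rewrite !inE H'A capvSr.
have [K [a [c [Kbasic a0 c0 HE]]]] := extreme_basic HA H'A neq.
have KA : K \in A by case: Kbasic => + _; rewrite !inE => /andP[].
have Kx : phi K x < 0 :> R.
  rewrite -(pmulr_rlt0 _ a0); move: Hx; rewrite HE.
  by have := mulr_ge0 c0 H'x; lra.
have Ky : 0 <= phi K y :> R.
  rewrite -(pmulr_rge0 _ a0); move: Hy; rewrite HE.
  by have := mulr_ge0_le0 c0 (ltW H'y); lra.
have Hbasic : basic (pencil A H H') (cone A phi b) H.
  apply: contrapT => Hnb; have := Hmin K KA Kx Ky.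
  by rewrite leqNgt rkQ //; exists (pencil A H H').
apply: rkQ => //; exists (pencil A H H'); split=> // H'basic.
by apply: indep; split; [exact/eqP|exists (pencil A H H')].
Qed.

End RankTwo.

(** * Colour scores *)

Lemma least_exists (P : nat -> Prop) : (exists m, P m) -> exists m, is_least P m.
Proof.
move=> [m Pm].
have ex : exists m, `[< P m >] by exists m; apply/asboolP.
case: (ex_minnP ex) => d /asboolP Pd dmin.
by exists d; split=> // k Pk; apply/dmin/asboolP.
Qed.

Section Combinatorics.
Context {T : choiceType}.
Implicit Types (V : {fset T}) (E : T -> T -> Prop).

Lemma colorable_card V E : (forall v, ~ E v v) -> colorable V E #|` V|.
Proof.
move=> irr; exists (fun v => index v V); split=> [v vV|u v uV vV Euv eqi].
  by rewrite index_mem.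
suff uv : u = v by apply: (irr v); rewrite -{1}uv.
by rewrite -(nth_index u uV) eqi nth_index.
Qed.

(** The number of ancestors, which strictly increases along the arcs of an
    acyclic digraph and so plays the role of a topological order. *)
Definition depth V E v : nat :=
  #|` [fset u in V | `[< clos_trans T E u v >]]|.

Lemma depth_lt V E u v : acyclic E -> u \in V -> E u v ->
  (depth V E u < depth V E v)%N.
Proof.
move=> acyc uV Euv; apply: fproper_ltn_card; rewrite fproperE; apply/andP; split.
  apply/fsubsetP => w; rewrite !inE => /andP[-> /asboolP wu] /=; apply/asboolP.
  by apply: t_trans wu _; exact: t_step.
apply/fsubsetPn; exists u; rewrite !inE uV /=; first by apply/asboolP/t_step.
by apply/asboolP/acyc.
Qed.

Section Scores.
Context {R : realType}.
Context (V : {fset T}) (col rk : T -> nat).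

(** The base exceeds the number of vertices, so one vertex outweighs all
    vertices of larger rank together. *)
Definition weight v : R := (#|` V|.+1%:R ^+ rk v)^-1.

Definition score (S : set T) (i : nat) : R :=
  \sum_(v : V) (if col (val v) == i then weight (val v) * `[< S (val v) >]%:R else 0).

Lemma weight_gt0 v : 0 < weight v.
Proof. by rewrite invr_gt0 exprn_gt0. Qed.

Lemma score_sub (S S' : set T) i : S `<=` S' -> score S i <= score S' i.
Proof.
move=> SS'; apply: ler_sum => v _; case: ifP => // _.
rewrite ler_pM2l ?weight_gt0 // ler_nat.
by case: asboolP => // /SS' Sv; rewrite asboolT.
Qed.

(** Among the vertices coloured as [h], those lost in passing from [S'] to [S]
    have larger rank than [h]: each costs at most [weight h / N], where [N] is
    one more than the number of vertices, so [h] alone makes the balance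
    positive. *)
Lemma score_lt (S S' : set T) h : h \in V -> S h -> ~ S' h ->
  (forall v, v \in V -> col v = col h -> S' v -> ~ S v -> (rk h < rk v)%N) ->
  score S' (col h) < score S (col h).
Proof.
move=> hV Sh S'h later.
rewrite -subr_gt0 /score -sumrB (bigD1 [` hV]) //= eqxx.
rewrite asboolT // asboolF // mulr1 mulr0 subr0.
pose N := #|` V|.+1; pose e := weight h / N%:R.
have N0 : 0 < N%:R :> R by rewrite ltr0n.
have he : weight h = e * N%:R by rewrite /e divfK ?gt_eqF.
have e0 : 0 < e by rewrite divr_gt0 ?weight_gt0.
have : \sum_(v : V | v != [` hV]) (- e) <=
  \sum_(v : V | v != [` hV])
   ((if col (val v) == col h then weight (val v) * `[< S (val v) >]%:R else 0) -
    (if col (val v) == col h then weight (val v) * `[< S' (val v) >]%:R else 0)).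
  apply: ler_sum => v _; case: eqP => [eqc|_]; last by rewrite subr0 oppr_le0 ltW.
  rewrite -mulrBr; have w0 := weight_gt0 (val v).
  case: (asboolP (S (val v))) => Sv; case: asboolP => S'v;
    rewrite ?subrr ?subr0 ?mulr0 ?mulr1 ?oppr_le0 ?(ltW e0) //.
    by apply: le_trans (ltW w0); rewrite oppr_le0 ltW.
  rewrite sub0r mulrN1 lerN2 /e /weight -invfM -exprSr.
  rewrite lef_pV2 ?posrE ?exprn_gt0 //.
  by rewrite ler_weXn2l ?ler1n // later // (valP v).
rewrite sumr_const => low.
have : - e *+ #|[pred v : V | v != [` hV]]| >= - e * #|` V|%:R.
  rewrite -[leRHS]mulr_natr !mulNr lerN2 ler_pM2l // ler_nat cardfE.
  exact: max_card.
move=> /le_trans/(_ low) {}low.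
by rewrite he /N -natr1 mulrDr mulr1; lra.
Qed.

(** If [S x] is not included in [S y], a difference [h] of least rank makes
    the score of the colour of [h] larger for [x] than for [y]. *)
Lemma scores_embed (X : Type) (P : set X) (S : X -> set T) k :
  (forall x v, P x -> S x v -> v \in V) ->
  (forall x y, P x -> P y -> S x = S y -> x = y) ->
  (forall v, v \in V -> (col v < k)%N) ->
  (forall x y h v, P x -> P y -> S x h -> ~ S y h ->
     (forall u, S x u -> ~ S y u -> (rk h <= rk u)%N) ->
     S y v -> ~ S x v -> col v = col h -> (rk h < rk v)%N) ->
  embeds_in_Rd R P (fun x y => S x `<=` S y) k.
Proof.
move=> SV Sinj colk later.
pose f x : 'rV[R]_k := \row_i score (S x) i.
have fle x y : P x -> P y -> (S x `<=` S y <-> forall i, f x 0 i <= f y 0 i).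
  move=> Px Py; split=> [xy i|fxy]; first by rewrite !mxE score_sub.
  apply: contrapT => nxy.
  have ex : exists m, `[< exists h, [/\ S x h, ~ S y h & rk h = m] >].
    have [h Sxh Syh] : exists2 h, S x h & ~ S y h.
      apply: contrapT => no; apply: nxy => h Sxh.
      by apply: contrapT => Syh; apply: no; exists h.
    by exists (rk h); apply/asboolP; exists h.
  case: (ex_minnP ex) => m /asboolP[h [Sxh Syh rkh]] hmin.
  have hV := SV x h Px Sxh.
  have := fxy (Ordinal (colk h hV)); rewrite !mxE leNgt /= score_lt // => v _ vh Sv Sxv.
  apply: (later x y) => // u Su Syu; rewrite rkh.
  by apply: hmin; apply/asboolP; exists u.
exists f; split=> // x y Px Py fxy; apply: Sinj => //.
by apply/seteqP; split; apply/fle => // i; rewrite fxy.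
Qed.

End Scores.
End Combinatorics.

(** * Order dimension and chromatic number *)

Theorem corollary4p4 (R : realType) (n : nat)
  (A : {fset {vspace 'rV[R]_n}}) (B : set 'rV[R]_n)
  (hA : arrangement A) (hB : region A B)
  (hQ : acyclic (basic_digraph A B)) :
  exists d k : nat,
    [/\ is_order_dimension R (region A) (region_le A B) d,
        is_chromatic_number A (basic_graph A B) k
      & (d <= k)%N].
Proof.
have irr H : ~ basic_graph A B H H by case.
have [k kP] := least_exists (ex_intro _ _ (colorable_card A irr)).
suff emb : embeds_in_Rd R (region A) (region_le A B) k.
  have [d dP] := least_exists (ex_intro _ _ emb).
  by exists d, k; split=> //; apply: dP.2.
have [[col [colk colE]] _] := kP.
have [b bA BE] := hB.
have [phi [ker phib]] := normalized_forms hA bA.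
rewrite (component_cell ker bA) (closure_cell ker bA) in BE.
have rkQ K K' : K \in A -> K' \in A -> basic_digraph A B K K' ->
    (depth A (basic_digraph A B) K < depth A (basic_digraph A B) K')%N.
  by move=> KA _; exact: depth_lt.
subst B.
apply: (scores_embed (V := A) (col := col)
          (rk := depth A (basic_digraph A (cone A phi b)))) => //.
- by move=> X H _ [].
- move=> X Y /(regionP X ker)[x xA ->] /(regionP Y ker)[y yA ->].
  exact: cone_eq.
move=> X Y H H' /(regionP X ker)[x xA ->] /(regionP Y ker)[y yA ->].
have sepx := sep_setP ker phib _ xA; have sepy := sep_setP ker phib _ yA.
have nsep z (sepz : forall K, sep_set A (cone A phi b) (cone A phi z) K <->
    K \in A /\ phi K z < 0 :> R) K : K \in A ->
    ~ sep_set A (cone A phi b) (cone A phi z) K -> 0 <= phi K z :> R.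
  by move=> KA nK; rewrite leNgt; apply/negP => Kz; apply/nK/sepz.
move=> /sepx[HA Hx] /(nsep _ sepy _ HA) Hy Hmin.
move=> /sepy[H'A H'y] /(nsep _ sepx _ H'A) H'x eqcol.
apply: (first_difference_rank hA ker phib rkQ HA H'A _ Hx Hy H'x H'y).
  by move/(colE _ _ HA H'A); rewrite eqcol.
move=> K KA Kx Ky; apply: Hmin; first exact/sepx.
by move=> /sepy[_]; rewrite ltNge Ky.
Qed.
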